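(* Let $P$ be a poset (resp., a dcpo) for which the set $\mathrm{Id}(P)$ of all ideals of $P$ is countable. Then $P$ is a $c$-poset (resp., a $c$-dcpo) and hence an $\ell f_\omega$-poset (resp., an $\ell f_\omega$-dcpo).
   Context: A subset $D$ of a poset is directed if it is nonempty and any two elements of $D$ have an upper bound in $D$. A dcpo is a poset in which every directed subset has a supremum. For $A\subseteq P$, $\mathord{\downarrow}A=\{x\in P: x\le a\text{ for some }a\in A\}$ and $\mathord{\uparrow}A=\{x\in P: x\ge a\text{ for some }a\in A\}$. ''Countable'' means finite or countably infinite. An ideal of a poset $P$ is a directed lower subset of $P$; $\mathrm{Id}(P)$ is the set of all ideals of $P$. The ideals $\mathord{\downarrow}x$ are principal; $\mathrm{Id}_{\neg p}(P)$ is the set of non-principal ideals. A poset (resp., dcpo) $P$ is a $c$-poset (resp., $c$-dcpo) if: (i) $\mathrm{Id}_{\neg p}(P)$ is countable, say $\mathrm{Id}_{\neg p}(P)=\{I_n : n\in N\}$ with $N\subseteq\mathbb{N}$ (possibly finite or empty); (ii) for each $n\in N$ there is a strictly ascending sequence $c_{(n,1)}<c_{(n,2)}<\cdots$ in $P$ with $I_n=\mathord{\downarrow}\{c_{(n,m)} : m\in\mathbb{N}\}$; (iii) there is a countable family $\{T_l : l\in\mathbb{N}\}$ of subsets of $P$ such that $P\setminus\bigcup_{n\in N}H_n=\bigcup_{l\in\mathbb{N}}T_l$ and every ideal of each poset $T_l$ (restricted order) is principal, where $H_n=\{c_{(n,m)} : m\in\mathbb{N}\}\cup\{\bigvee_m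 c_{(n,m)}\}$ if $\bigvee_m c_{(n,m)}$ exists in $P$, and $H_n=\{c_{(n,m)} : m\in\mathbb{N}\}$ otherwise. Scott topology: $U\subseteq P$ is Scott open if $U=\mathord{\uparrow}U$ and, for every directed $D\subseteq P$ such that $\bigvee D$ exists, $\bigvee D\in U$ implies $D\cap U\neq\emptyset$. $\Sigma P$ denotes $P$ with the Scott topology. A d-sub-poset of a poset $T$ is a subset $S\subseteq T$ with the restricted order such that $\bigvee_T D\in S$ for every directed $D\subseteq S$ for which $\bigvee_T D$ exists. A sub-dcpo of a dcpo $T$ is a subset $S$ with the restricted order such that $\bigvee_T D\in S$ for every directed $D\subseteq S$. A $T_0$ space $X$ is locally finite if for each $x\in X$ and each open neighborhood $U$ of $x$ there is a nonempty finite $F\subseteq X$ such that $\mathord{\uparrow}F$ (in the specialization order) is open and $x\in\mathord{\uparrow}F\subseteq U$. A poset (resp., dcpo) $P$ is an $\ell f_\omega$-poset (resp., $\ell f_\omega$-dcpo) if there is a sequence $(K_n)_{n\in\mathbb{N}}$ of d-sub-posets (resp., sub-dcpos) of $P$ such that: (a) $\Sigma K_n$ is locally finite for every $n$; (b) $K_n\subseteq K_m$ whenever $n\le m$; (c) $P=\bigcup_n K_n$; (d) $U\subseteq P$ is Scott open in $P$ iff $U\cap K_n$ is Scott open in $K_n$ for each $n$. *)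

(* Defs.v *)
From HB Require Import structures.
From mathcomp Require Import all_boot all_order.
From mathcomp Require Import all_classical topology.

Set Implicit Arguments.
Unset Strict Implicit.
Unset Printing Implicit Defensive.

Import Order.TTheory.
Local Open Scope classical_set_scope.
Local Open Scope order_scope.

(* A subset of a poset, seen as the type [set_type A], carries the restricted
   order. *)
HB.instance Definition _ (d : Order.disp_t) (P : porderType d) (A : set P) :=
  SubChoice.copy (set_type A) {x : P | x \in A}.
HB.instance Definition _ (d : Order.disp_t) (P : porderType d) (A : set P) :=
  [SubChoice_isSubPOrder of set_type A by <: with d].

Section Posets.
Variables (d : Order.disp_t) (P : porderType d).
Implicit Types (x y z : P) (A D I U S : set P).

Definition up A : set P := [set x | exists2 a, A a & a <= x].

Definition directed D :=
  D !=set0 /\ forall x y, D x -> D y -> exists z, [/\ D z, x <= z & y <= z].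

(* The supremum of [D] exists iff [supremums D], the set of least upper bounds
   of [D] (which has at most one element), is nonempty. *)
Definition dcpo := forall D, directed D -> supremums D !=set0.

Definition ideal I := directed I /\ (forall x y, I y -> x <= y -> I x).

Definition principal I := exists x, I = down [set x].

Definition ideals : set (set P) := [set I | ideal I].

Definition nonprincipal_ideals : set (set P) :=
  [set I | ideal I /\ ~ principal I].

Definition scott_open U :=
  U = up U /\
  forall D x, directed D -> supremums D x -> U x -> D `&` U !=set0.

Definition d_subposet S :=
  forall D x, directed D -> D `<=` S -> supremums D x -> S x.

Definition sub_dcpo S :=
  forall D, directed D -> D `<=` S -> exists2 x, supremums D x & S x.

(* [supremums (range s)] is empty when the supremum of the sequence does not
   exist, and is otherwise the singleton of that supremum. *)
Definition chain_hull (s : nat -> P) : set P :=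
  range s `|` supremums (range s).

End Posets.

Arguments dcpo {d} P.
Arguments ideals {d} P.
Arguments nonprincipal_ideals {d} P.

(* The index set N is used as a type, so that the sequences c n are only
   required for n in N; in particular N and P may be empty. *)
Definition c_poset (d : Order.disp_t) (P : porderType d) :=
  countable (nonprincipal_ideals P) /\
  exists (N : set nat) (I : N -> set P) (c : N -> nat -> P) (T : nat -> set P),
  [/\ nonprincipal_ideals P = range I,
      forall n : N,
        (forall m : nat, c n m < c n m.+1) /\ I n = down (range (c n)),
      ~` (\bigcup_(n : N) chain_hull (c n)) = \bigcup_(l : nat) T l &
      forall (l : nat) (J : set (T l)), ideal J -> principal J].

Definition c_dcpo (d : Order.disp_t) (P : porderType d) :=
  dcpo P /\ c_poset P.

Section ScottTopology.
Variables (d : Order.disp_t) (P : porderType d).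
Implicit Types U V : set P.

Lemma up_id U : (forall x y, U x -> x <= y -> U y) -> U = up U.
Proof.
move=> upU; apply/seteqP; split=> [x Ux|y [x Ux xy]]; first by exists x.
exact: upU xy.
Qed.

Lemma scott_open_up U x y : scott_open U -> U x -> x <= y -> U y.
Proof. by move=> [-> _] [z Uz zx] xy; exists z => //; exact: le_trans xy. Qed.

Lemma scott_openT : scott_open [set: P].
Proof.
split; first exact: up_id.
by move=> D x [[y Dy] _] _ _; exists y.
Qed.

Lemma scott_openI : setI_closed (@scott_open d P).
Proof.
move=> U V oU oV; split.
  apply: up_id => x y [Ux Vx] xy.
  by split; [exact: scott_open_up oU Ux xy|exact: scott_open_up oV Vx xy].
move=> D x dD Dx [Ux Vx].
have [a [Da Ua]] := oU.2 D x dD Dx Ux.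
have [b [Db Vb]] := oV.2 D x dD Dx Vx.
have [z [Dz az bz]] := dD.2 a b Da Db.
exists z; split=> //.
by split; [exact: scott_open_up oU Ua az|exact: scott_open_up oV Vb bz].
Qed.

Lemma scott_open_bigU (I : Type) (f : I -> set P) :
  (forall i, scott_open (f i)) -> scott_open (\bigcup_i f i).
Proof.
move=> of_; split.
  by apply: up_id => x y [i _ fx] xy; exists i => //; exact: scott_open_up xy.
move=> D x dD Dx [i _ fx].
by have [a [Da fa]] := (of_ i).2 D x dD Dx fx; exists a; split=> //; exists i.
Qed.

End ScottTopology.

(* The space Sigma P: the carrier of P with the Scott topology. *)
Definition scott (d : Order.disp_t) (P : porderType d) : Type := P.

HB.instance Definition _ (d : Order.disp_t) (P : porderType d) :=
  Choice.on (scott P).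
HB.instance Definition _ (d : Order.disp_t) (P : porderType d) :=
  isOpenTopological.Build (scott P)
    (@scott_openT d P) (@scott_openI d P) (@scott_open_bigU d P).

(* x is below y in the specialization order iff x is in the closure of {y}. *)
Definition spec_up (X : topologicalType) (F : set X) : set X :=
  [set y | exists2 x, F x & closure [set y] x].

Definition locally_finite (X : topologicalType) :=
  kolmogorov_space X /\
  forall (x : X) (U : set X), open U -> U x ->
    exists F : set X,
      [/\ F !=set0, finite_set F, open (spec_up F), spec_up F x &
          spec_up F `<=` U].

(* [sub] is the class of admissible subsets: d-sub-posets or sub-dcpos.  The
   trace of U on K_n is the preimage of U under the inclusion of K_n. *)
Definition lf_omega (d : Order.disp_t) (P : porderType d)
    (sub : set P -> Prop) :=
  exists K : nat -> set P,
  [/\ forall n : nat, sub (K n),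
      forall n : nat, locally_finite (scott (K n)),
      forall n m : nat, (n <= m)%N -> K n `<=` K m,
      [set: P] = \bigcup_(n : nat) K n &
      forall U : set P,
        open (U : set (scott P)) <->
        forall n : nat, open ([set x : K n | U (val x)] : set (scott (K n)))].

Definition lf_omega_poset (d : Order.disp_t) (P : porderType d) :=
  lf_omega (@d_subposet d P).

Definition lf_omega_dcpo (d : Order.disp_t) (P : porderType d) :=
  dcpo P /\ lf_omega (@sub_dcpo d P).

(* Main.v *)
Require Import Defs.
From mathcomp Require Import all_boot all_order.
From mathcomp Require Import all_classical topology.

(** A principal ideal determines its generator, so a poset [P] with countably
many ideals is itself countable.  An injection [e] of the ideals into [nat]
therefore ranks both the ideals [I], by [e I], and the points [x], by
[e (down [set x])].

[P] is a c-poset because every nonprincipal ideal of a countable poset is the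
down-closure of a strictly ascending sequence ([exists_ascending]), and
because the countable set left over by the chain hulls is a union of singletons,
whose only ideals are principal.

For the lf_omega structure, [K n] consists of the points of rank at most [n]
together with the chain hulls of the nonprincipal ideals of rank at most [n]
_that have a supremum in P_.  Chains without a supremum must not be put into
[K n] whole: they could acquire a supremum in the smaller poset [K n], and an
open set of [P] would then have no reason to be open in [K n].  Excluding them
costs nothing, since they impose no condition on the open sets of [P].

So [K n] is a finite set plus finitely many ascending chains with their suprema.
By pigeonhole, a directed subset of [K n] without a greatest element generates
the same ideal as one of these chains ([directed_chain_union]).  Three things
follow.  Every directed subset of [K n] has a supremum in [P] that lies in [K n]
([chain_union_sub_dcpo]), so [K n] is a sub-dcpo even if [P] is not a dcpo;
suprema in [K n] and in [P] then agree, which gives one half of the coherence of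
the Scott topologies ([scott_open_restr]).  The other half
([scott_open_of_traces]) holds because each chain with a supremum eventually
lies in some [K n].  Finally [K n] has only finitely many nonprincipal ideals,
and such a poset is locally finite: to make the upper set of [x] open inside [U]
it suffices to add to [x] one point of [U] from each nonprincipal ideal that
meets [U] ([locally_finite_scott]). *)

Import Order.TTheory.
Local Open Scope classical_set_scope.
Local Open Scope order_scope.

(** * Directed sets, ideals and ascending sequences *)

Section DirectedSets.
Context {d : Order.disp_t} {P : porderType d}.
Implicit Types (x y : P) (A B D F I : set P) (s : nat -> P).

Lemma sub_down D : D `<=` down D.
Proof. by move=> x Dx; exists x. Qed.

Lemma down1E x : down [set x] = [set y | y <= x].
Proof.
by apply/seteqP; split=> [y [_ [-> ]]|y yx] //; exists x.
Qed.

Lemma down1_inj : injective (fun x => down [set x]).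
Proof.
move=> x y; rewrite !down1E => /seteqP[xy yx].
by apply/le_anti/andP; split; [exact: xy (lexx x)|exact: yx (lexx y)].
Qed.

Lemma ideal_down D : directed D -> ideal (down D).
Proof.
move=> [[a Da] dirD]; split; last first.
  by move=> x y [z [Dz yz]] xy; exists z; split=> //; exact: le_trans yz.
split; first by exists a; exact: sub_down.
move=> x y [x' [Dx' xx']] [y' [Dy' yy']].
have [z [Dz x'z y'z]] := dirD _ _ Dx' Dy'.
exists z; split; first exact: sub_down.
  exact: le_trans x'z.
exact: le_trans y'z.
Qed.

Lemma ideal_down1 x : ideal (down [set x]).
Proof.
apply: ideal_down; split; first by exists x.
by move=> _ _ -> ->; exists x.
Qed.

Lemma supremums_down D : supremums (down D) = supremums D.
Proof.
have ubE : ubound (down D) = ubound D.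
  apply/seteqP; split=> [x ubx y Dy|x ubx y [z [Dz yz]]].
    by apply: ubx; exact: sub_down.
  by apply: (le_trans yz); exact: ubx.
by rewrite /supremums ubE.
Qed.

Lemma supremums_down1 x : supremums (down [set x]) = [set x].
Proof. by rewrite supremums_down supremums1. Qed.

Lemma down_eq1 D x : down D = down [set x] -> D x.
Proof.
move=> Dx.
have [y [Dy xy]] : down D x by rewrite Dx; exact: sub_down.
suff -> : x = y by [].
apply/le_anti; rewrite xy /=.
by have := sub_down _ _ Dy; rewrite Dx down1E.
Qed.

Lemma finite_supremums D : finite_set (supremums D).
Proof.
have [[x Dx]|noD] := pselect (supremums D !=set0); last first.
  by apply: sub_finite_set (finite_set0 P) => x Dx; apply: noD; exists x.
apply: sub_finite_set (finite_set1 x) => y Dy.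
exact: is_subset1_supremums Dy Dx.
Qed.

Lemma down_max D x : D x -> (forall y, D y -> y <= x) -> down D = down [set x].
Proof.
move=> Dx xmax; rewrite down1E; apply/seteqP; split=> [y [z [Dz yz]]|y yx].
  by apply: (le_trans yz); exact: xmax.
by exists x.
Qed.

Lemma down_cofinal {A B} :
  A `<=` down B -> B `<=` down A -> down A = down B.
Proof.
move=> AB BA; apply/seteqP; split=> x [y [yy xy]].
  by have [z [Bz yz]] := AB _ yy; exists z; split=> //; exact: le_trans yz.
by have [z [Bz yz]] := BA _ yy; exists z; split=> //; exact: le_trans yz.
Qed.

Lemma directed_finite_ub D F :
  directed D -> finite_set F -> F `<=` D -> exists2 z, D z & ubound F z.
Proof.
move=> [[a Da] dirD] /finite_seqP[t ->{F}].
elim: t => [|x t IH] tD; first by exists a.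
have [y Dy uby] : exists2 z, D z & ubound [set` t] z.
  by apply: IH => y yt; apply: tD; rewrite /= inE yt orbT.
have [z [Dz xz yz]] := dirD x y (tD x (mem_head _ _)) Dy.
exists z => // u; rewrite /= inE => /predU1P[->//|ut].
by apply: le_trans yz; exact: uby.
Qed.

(** Pigeonhole for directed sets: if no piece were cofinal, each would fail to
dominate some element of [D]; an upper bound in [D] of these finitely many
elements lies in no piece. *)
Lemma directed_cofinal_piece {J : Type} {A : set J} {B : J -> set P} {D} :
  directed D -> finite_set A -> D `<=` \bigcup_(j in A) B j ->
  exists2 j, A j & D `<=` down (D `&` B j).
Proof.
move=> dirD finA DB; apply: contrapT => noj.
have /choice[g gP] : forall j, exists x,
    D x /\ (A j -> ~ down (D `&` B j) x).
  move=> j; have [Aj|nAj] := pselect (A j); last first.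
    by have [a Da] := dirD.1; exists a.
  apply: contrapT => nog; apply: noj; exists j => // x Dx.
  by apply: contrapT => nx; apply: nog; exists x.
have [z Dz ubz] : exists2 z, D z & ubound (g @` A) z.
  apply: directed_finite_ub => //; first exact: finite_image.
  by move=> _ [j Aj <-]; exact: (gP j).1.
have [j Aj Bz] := DB z Dz.
apply: (gP j).2 => //; exists z; split=> //.
by apply: ubz; exists j.
Qed.

Definition ascending_to s I :=
  (forall m : nat, s m < s m.+1) /\ I = down (range s).

Lemma ascending_le {s I m n} : ascending_to s I -> (m <= n)%N -> s m <= s n.
Proof.
move=> [asc _] mn; rewrite -(subnK mn); elim: (n - m)%N => // k IH.
by apply: (le_trans IH); exact: ltW.
Qed.

Lemma directed_ascending s I : ascending_to s I -> directed (range s).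
Proof.
move=> asc; split; first by exists (s 0%N), 0%N.
move=> _ _ [m _ <-] [n _ <-]; exists (s (maxn m n)).
by split; [exists (maxn m n)|apply: (ascending_le asc)..];
  rewrite ?leq_maxl ?leq_maxr.
Qed.

Lemma nonprincipal_above {I} x :
  nonprincipal_ideals P I -> I x -> exists2 y, I y & ~~ (y <= x).
Proof.
move=> [[dirI lowI] npI] Ix; apply: contrapT => noy; apply: npI.
exists x; rewrite down1E; apply/seteqP; split=> y; last exact: lowI.
by move=> Iy; apply: contrapT => /negP yx; apply: noy; exists y.
Qed.

(** The sequence is built by climbing strictly, which is possible because a
nonprincipal ideal has no greatest element, while at step [n] passing above the
element with code [n], if any; this makes the sequence cofinal. *)
Lemma exists_ascending I :
  countable I -> nonprincipal_ideals P I -> exists s, ascending_to s I.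
Proof.
move=> /countable_injP[f injf] npI.
have [[[[a Ia] dirI] lowI] _] := npI.
have /choice[next nextP] : forall p : nat * P, exists y, I p.2 ->
    [/\ I y, p.2 < y & forall x, I x -> f x = p.1 -> x <= y].
  move=> [n x] /=; have [Ix|nIx] := pselect (I x); last by exists a.
  have [y Iy yx] := nonprincipal_above x npI Ix.
  have [z [Iz xz yz]] := dirI x y Ix Iy.
  have xltz : x < z.
    rewrite lt_neqAle xz andbT; apply: contra_notN (negP yx) => /eqP ->.
    exact: yz.
  (* [z] already climbs strictly; it remains to dominate the point coded by [n]. *)
  have [[u Iu fu]|nou] := pselect (exists2 u, I u & f u = n); last first.
    by exists z => _; split=> // u Iu fu; exfalso; apply: nou; exists u.
  have [w [Iw zw uw]] := dirI z u Iz Iu.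
  exists w => _; split=> //; first exact: lt_le_trans zw.
  move=> v Iv fv; suff -> : v = u by [].
  by apply: injf; rewrite ?inE // fv fu.
pose s := fix s m := if m is n.+1 then next (n, s n) else a.
have Is m : I (s m) by elim: m => //= n /(nextP (n, s n))[].
exists s; split=> [m|]; first by have [] := nextP (m, s m) (Is m).
apply/seteqP; split=> [x Ix|x [_ [[m _ <-] xs]]]; last exact: lowI xs.
exists (s (f x).+1); split; first by exists (f x).+1.
by have [_ _] := nextP (f x, s (f x)) (Is _); exact.
Qed.

End DirectedSets.

(** * The c-poset structure *)

Section CPoset.
Context {d : Order.disp_t} {P : porderType d}.

Lemma countable_of_ideals (A : set P) : countable (ideals P) -> countable A.
Proof.
move=> /countable_injP[e inje]; apply/countable_injP.
exists (fun x => e (down [set x])) => x y _ _ exy.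
apply: down1_inj; apply: inje exy; rewrite inE; exact: ideal_down1.
Qed.

(** The index set [N] is the set of codes of the nonprincipal ideals, and the
[T l] are the singletons (or empty sets) cut out of the remaining points by an
injection of [P] into [nat]. *)
Lemma c_poset_of_countable_ideals : countable (ideals P) -> c_poset P.
Proof.
move=> cId.
have cnp : countable (nonprincipal_ideals P).
  by apply: sub_countable cId; apply: subset_card_le => I [].
split=> //.
have /countable_injP[e inje] := cnp.
have /countable_injP[f injf] := countable_of_ideals [set: P] cId.
pose N := e @` nonprincipal_ideals P.
have /choice[I IP] : forall n : N, exists I,
    nonprincipal_ideals P I /\ e I = val n.
  by move=> n; have [I npI eI] := set_valP n; exists I.
have /choice[c cP] : forall n : N, exists s, ascending_to s (I n).
  move=> n; apply: exists_ascending (IP n).1.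
  exact: countable_of_ideals.
pose C := ~` (\bigcup_(n : N) chain_hull (c n)).
exists N, I, c, (fun l => [set x | C x /\ f x = l]); split.
- apply/seteqP; split=> [J npJ|_ [n _ <-]]; last exact: (IP n).1.
  have NJ : N (e J) by exists J.
  exists (SigSub (mem_set NJ)) => //.
  have [npI eI] := IP (SigSub (mem_set NJ)).
  by apply: inje => //; rewrite inE.
- exact: cP.
- apply/seteqP; split=> [x Cx|x [l _ []//]].
  by exists (f x).
- move=> l J [[[x Jx] _] _]; exists x.
  have eqx y : y = x.
    apply: val_inj; apply: injf; rewrite ?inE //.
    by rewrite (set_valP y).2 (set_valP x).2.
  rewrite down1E; apply/seteqP; split=> y _ /=; first by rewrite (eqx y).
  by rewrite (eqx y).
Qed.

End CPoset.

(** * Finite unions of points and chain hulls *)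

Section ChainUnions.
Context {d : Order.disp_t} {P : porderType d} {J : Type}.
Context {A : set J} {F : set P} {s : J -> nat -> P} {I : J -> set P}.
Hypotheses (finA : finite_set A) (finF : finite_set F).
Hypothesis asc : forall j, A j -> ascending_to (s j) (I j).

(** If [down D] is not principal, its intersection with the chain cannot stop:
above [s j m] there must be another element of [D], hence a later term of the
chain in [D]. *)
Lemma directed_frequently_ascending j D :
  A j -> directed D -> D `<=` down (D `&` range (s j)) ->
  principal (down D) \/ down D = I j.
Proof.
move=> Aj dirD cof; have ascj := asc _ Aj.
have [|npD] := pselect (principal (down D)); first by left.
right; rewrite ascj.2; apply: down_cofinal => [x Dx|_ [m _ <-]].
  by have [y [[_ sy] xy]] := cof x Dx; exists y.
elim: m => [|m [x [Dx smx]]].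
  have [x /cof[y [[Dy [k _ sk]] _]]] := dirD.1; rewrite -sk in Dy.
  by exists (s j k); split=> //; apply: (ascending_le ascj).
have [y [z [Dz yz]] nyx] : exists2 y, down D y & ~~ (y <= s j m).
  apply: nonprincipal_above; first by split=> //; exact: ideal_down.
  by exists x.
have [w [[Dw [k _ sk]] zk]] := cof z Dz; rewrite -sk in Dw zk.
exists (s j k); split=> //; apply: (ascending_le ascj).
rewrite ltnNge; apply: contraNN nyx => km.
by apply: (le_trans yz); apply: (le_trans zk); exact: (ascending_le ascj).
Qed.

(** A cofinal singleton piece is a greatest element; a cofinal chain piece is
handled by [directed_frequently_ascending]. *)
Lemma directed_chain_union {D} :
  directed D -> D `<=` F `|` \bigcup_(j in A) chain_hull (s j) ->
  principal (down D) \/ exists2 j, A j & down D = I j.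
Proof.
move=> dirD DK.
(* The pieces are singletons, for the isolated points and the suprema of the
   chains, and the chains themselves. *)
pose G := F `|` \bigcup_(j in A) supremums (range (s j)).
pose piece (u : P + J) :=
  match u with inl x => [set x] | inr j => range (s j) end.
have finG : finite_set G.
  rewrite finite_setU; split=> //; apply: bigcup_finite => // j _.
  exact: finite_supremums.
have finGA : finite_set ((inl @` G) `|` (inr @` A) : set (P + J)).
  by rewrite finite_setU; split; exact: finite_image.
have [|u] := directed_cofinal_piece (B := piece) dirD finGA.
  move=> x /DK[Fx|[j Aj [sx|supx]]].
  - by exists (inl x) => //; left; exists x => //; left.
  - by exists (inr j) => //; right; exists j.
  - by exists (inl x) => //; left; exists x => //; right; exists j.
case=> -[a Aa <-] /= cof; last first.
  have [|->] := directed_frequently_ascending a D Aa dirD cof; first by left.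
  by right; exists a.
left; exists a; have [x /cof[y [[Dy ya] _]]] := dirD.1.
rewrite ya in Dy; apply: down_max => // z /cof[w [[_ ->]]]; exact.
Qed.

Lemma chain_union_sub_dcpo :
  (forall j, A j -> supremums (I j) !=set0) ->
  sub_dcpo (F `|` \bigcup_(j in A) chain_hull (s j)).
Proof.
move=> supI D dirD DK.
have [[x Dx]|[j Aj DI]] := directed_chain_union dirD DK.
  exists x; first by rewrite -supremums_down Dx supremums_down1.
  by apply: DK; exact: down_eq1.
have [x Ix] := supI j Aj; exists x; first by rewrite -supremums_down DI.
right; exists j => //; right; rewrite -supremums_down -(asc _ Aj).2; exact: Ix.
Qed.

End ChainUnions.

(** * Directed sets, ideals and Scott-open sets of a subset *)

Section Restriction.
Context {d : Order.disp_t} {P : porderType d} {K : set P}.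
Implicit Types (D : set K) (x : K).

Lemma directed_val {D} : directed D -> directed (val @` D).
Proof.
move=> [[a Da] dirD]; split; first by exists (val a), a.
move=> _ _ [x Dx <-] [y Dy <-]; have [z [Dz xz yz]] := dirD x y Dx Dy.
by exists (val z); split; [exists z|rewrite Order.le_val..].
Qed.

Lemma directed_preimage_val (E : set P) :
  E `<=` K -> directed E -> directed (val @^-1` E : set K).
Proof.
move=> EK [[a Ea] dirE].
split; first by exists (SigSub (mem_set (EK a Ea))).
move=> x y Ex Ey; have [z [Ez xz yz]] := dirE _ _ Ex Ey.
by exists (SigSub (mem_set (EK z Ez))); split; rewrite -?Order.le_val.
Qed.

Lemma image_preimage_val {E : set P} :
  E `<=` K -> val @` (val @^-1` E : set K) = E.
Proof.
move=> EK; apply/seteqP; split=> [_ [z Ez <-]//|z Ez].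
by exists (SigSub (mem_set (EK z Ez))).
Qed.

Lemma supremums_val D x : supremums (val @` D) (val x) -> supremums D x.
Proof.
move=> [ubx lbx]; split=> [y Dy|y uby]; rewrite -Order.le_val.
  by apply: ubx; exists y.
by apply: lbx => _ [z Dz <-]; rewrite Order.le_val; exact: uby.
Qed.

(** The restricted order can create suprema that are not suprema in [P]; when
[K] is a sub-dcpo it cannot, since the supremum in [P] already lies in [K]. *)
Lemma sub_dcpo_supremums_val D x :
  sub_dcpo K -> directed D -> supremums D x -> supremums (val @` D) (val x).
Proof.
move=> dcK dirD Dx.
have [|y Dy Ky] := dcK _ (directed_val dirD).
  by move=> _ [z _ <-]; exact: set_valP.
rewrite (_ : val x = y) //.
have Dy' : supremums D (SigSub (mem_set Ky)) by exact: supremums_val.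
by rewrite (is_subset1_supremums Dx Dy').
Qed.

Lemma ideal_val_down {D} :
  ideal D -> D = [set x | down (val @` D) (val x)].
Proof.
move=> [_ lowD]; apply/seteqP; split=> x.
  by move=> Dx; exists (val x); split=> //; exists x.
by move=> [_ [[y Dy <-]]]; rewrite Order.le_val; exact: lowD.
Qed.

(** An ideal of [K] is the trace of the ideal of [P] that it generates
([ideal_val_down]), so the nonprincipal ideals of [K] are among the traces of
the members of [S]. *)
Lemma finite_nonprincipal_ideals_restr (S : set (set P)) :
  finite_set S ->
  (forall E : set P, directed E -> E `<=` K -> principal (down E) \/ S (down E)) ->
  finite_set (nonprincipal_ideals K).
Proof.
move=> finS ES.
apply: (sub_finite_set (B := (fun I => [set x : K | I (val x)]) @` S));
  last exact: finite_image.
move=> D [idD npD]; exists (down (val @` D)); last first.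
  by rewrite -ideal_val_down.
have [||[x Dx]|//] := ES (val @` D); first exact: directed_val idD.1.
  by move=> _ [z _ <-]; exact: set_valP.
have [y Dy yx] := down_eq1 _ _ Dx.
case: npD; exists y; rewrite down1E; apply/seteqP; split=> z /=.
  move=> Dz; rewrite -Order.le_val yx.
  suff: down (val @` D) (val z) by rewrite Dx down1E.
  by apply: sub_down; exists z.
by move=> zy; exact: idD.2 zy.
Qed.

Lemma scott_open_restr (U : set P) :
  sub_dcpo K -> scott_open U -> scott_open [set x : K | U (val x)].
Proof.
move=> dcK oU; split.
  apply: up_id => x y Ux; rewrite -Order.le_val; exact: scott_open_up.
move=> D x dirD Dx Ux.
have [||_ [[z Dz <-] Uz]] := oU.2 (val @` D) (val x) _ _ Ux.
- exact: directed_val.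
- exact: sub_dcpo_supremums_val.
- by exists z.
Qed.

End Restriction.

(** * Posets with finitely many nonprincipal ideals *)

Section LocallyFinite.
Context {d : Order.disp_t} {P : porderType d}.
Implicit Types (x y : P) (D U F : set P).

Lemma scott_open_not_below y : scott_open (~` down [set y]).
Proof.
rewrite down1E; split.
  by apply: up_id => x z /= nxy xz zy; apply: nxy; exact: le_trans zy.
move=> D x dirD [_ lbx] nxy; apply: contrapT => noz; apply: nxy.
apply: lbx => z Dz; apply: contrapT => nzy; apply: noz; by exists z.
Qed.

(** This identifies the specialization order of the Scott topology with the
original order. *)
Lemma closure_scott1 y : closure ([set y] : set (scott P)) = down [set y].
Proof.
rewrite down1E; apply/seteqP; split=> x /=.
  move=> clx; apply: contrapT => nxy.
  have [|_ [-> ]] := clx (~` down [set y]).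
    apply: open_nbhs_nbhs; split; first exact: scott_open_not_below.
    by rewrite down1E.
  by apply; rewrite down1E /=.
move=> xy B; rewrite nbhsE => -[U [oU Ux] UB].
exists y; split=> //; apply: UB; exact: (scott_open_up oU Ux xy).
Qed.

Lemma spec_up_scott F : spec_up (F : set (scott P)) = up F.
Proof.
apply/seteqP; split=> y [x Fx].
  by rewrite closure_scott1 down1E; exists x.
by move=> xy; exists x => //; rewrite closure_scott1 down1E.
Qed.

Lemma kolmogorov_scott : kolmogorov_space (scott P).
Proof.
have sep (x y : scott P) : ~~ ((x : P) <= y) ->
    exists2 A : set (scott P), nbhs x A & ~ A y.
  move=> nxy; exists (~` down [set y : P]).
    apply: open_nbhs_nbhs; split; first exact: scott_open_not_below.
    by rewrite down1E; exact/negP.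
  by rewrite down1E; apply; exact: lexx.
move=> x y nxy; have [xy|/sep[A Ax Ay]] := boolP ((x : P) <= y).
  have /sep[A Ay Ax] : ~~ ((y : P) <= x).
    by apply: contraNN nxy => yx; apply/eqP/le_anti; rewrite xy.
  by exists A; right; rewrite !inE.
by exists A; left; rewrite !inE.
Qed.

(** The supremum of a directed set [D] whose ideal is principal belongs to [D], so
only nonprincipal ideals can obstruct the openness of an upper set.  If the
supremum of such an ideal is in [U], the ideal meets [U]; with a point of that
intersection among the generators, [D] meets the upper set. *)
Lemma locally_finite_scott :
  finite_set (nonprincipal_ideals P) -> locally_finite (scott P).
Proof.
move=> finI; split; first exact: kolmogorov_scott.
move=> x U oU Ux.
(* [g I] lies in [I] only when [I] meets [U]; the default value is [x]. *)
have /choice[g gP] : forall I : set P, exists y, U y /\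
    (I `&` U !=set0 -> I y).
  move=> I; have [[y [Iy Uy]]|noy] := pselect (I `&` U !=set0).
    by exists y.
  by exists x; split.
pose F : set P := [set x] `|`
  g @` [set I | nonprincipal_ideals P I /\ I `&` U !=set0].
have FU : up F `<=` U.
  move=> y [z Fz zy]; apply: (scott_open_up oU _ zy).
  by case: Fz => [->//|[I _ <-]]; exact: (gP I).1.
have Fx : up F x by exists x => //; left.
have upF y z : up F y -> y <= z -> up F z.
  by move=> [w Fw wy] yz; exists w => //; exact: le_trans yz.
exists F; rewrite spec_up_scott; split=> //; first by exists x; left.
  rewrite finite_setU; split=> //; apply: finite_image.
  by apply: sub_finite_set finI => I [].
split; first exact: up_id.
move=> D y dirD Dy Fy.
have [[z Dz]|npD] := pselect (principal (down D)).
  exists z; split; first exact: down_eq1.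
  move: Dy; rewrite -supremums_down Dz supremums_down1 => yz.
  by rewrite -yz.
have DU : down D `&` U !=set0.
  have [z [Dz Uz]] := oU.2 D y dirD Dy (FU y Fy).
  by exists z; split=> //; exact: sub_down.
have [z [Dz gz]] := (gP (down D)).2 DU.
exists z; split=> //; exists (g (down D)) => //; right; exists (down D) => //.
by split=> //; split=> //; exact: ideal_down.
Qed.

End LocallyFinite.

(** * The lf_omega structure *)

Section LfOmega.
Context {d : Order.disp_t} {P : porderType d}.

(** Only directed sets with a nonprincipal ideal and a supremum test the openness
of an upper set, so the family [K] detects open sets as soon as each of these
ideals has a cofinal directed part that lies, with its supremum, in one [K n]. *)
Lemma scott_open_of_traces (K : nat -> set P) (U : set P) :
  (forall n m : nat, (n <= m)%N -> K n `<=` K m) ->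
  [set: P] = \bigcup_n K n ->
  (forall I x, nonprincipal_ideals P I -> supremums I x ->
    exists n E, [/\ directed E, I = down E, E `<=` K n & K n x]) ->
  (forall n, scott_open [set x : K n | U (val x)]) -> scott_open U.
Proof.
move=> monK covK idK oU.
have upU x y : U x -> x <= y -> U y.
  move=> Ux xy.
  have [n _ Kx] : (\bigcup_n K n) x by rewrite -covK.
  have [m _ Ky] : (\bigcup_n K n) y by rewrite -covK.
  pose x' : K (maxn n m) := SigSub (mem_set (monK _ _ (leq_maxl n m) _ Kx)).
  pose y' : K (maxn n m) := SigSub (mem_set (monK _ _ (leq_maxr n m) _ Ky)).
  have xy' : x' <= y' by rewrite -Order.le_val.
  exact: (scott_open_up (oU (maxn n m)) (Ux : [set z | U (val z)] x') xy').
split; first exact: up_id.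
move=> D x dirD Dx Ux.
have [[z Dz]|npD] := pselect (principal (down D)).
  exists z; split; first exact: down_eq1.
  by move: Dx; rewrite -supremums_down Dz supremums_down1 => <-.
have npID : nonprincipal_ideals P (down D).
  by split=> //; exact: ideal_down.
have DDx : supremums (down D) x by rewrite supremums_down.
have [n [E [dirE DE EK Kx]]] := idK _ _ npID DDx.
have [|||y [Ey Uy]] := (oU n).2 (val @^-1` E) (SigSub (mem_set Kx)).
- exact: directed_preimage_val.
- apply: supremums_val; rewrite (image_preimage_val EK).
  by rewrite -supremums_down -DE.
- exact: Ux.
have [z [Dz yz]] : down D (val y) by rewrite DE; exact: sub_down.
by exists z; split=> //; exact: upU yz.
Qed.

(** The members of the family are sub-dcpos whether or not [P] is a dcpo, which
covers both the poset and the dcpo version. *)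
Lemma lf_omega_sub_dcpo : countable (ideals P) -> lf_omega (@sub_dcpo d P).
Proof.
move=> cId; have /countable_injP[e inje] := cId.
have /choice[s asc] : forall I : nonprincipal_ideals P,
    exists s, ascending_to s (val I).
  move=> I; apply: exists_ascending (set_valP I); exact: countable_of_ideals.
pose F n := [set x : P | (e (down [set x]) <= n)%N].
pose A n := [set I : nonprincipal_ideals P |
  (e (val I) <= n)%N /\ supremums (val I) !=set0].
pose K n := F n `|` \bigcup_(I in A n) chain_hull (s I).
have finle (T : Type) (h : T -> nat) n :
    injective h -> finite_set [set t | (h t <= n)%N].
  move=> injh; apply: (finite_preimage (B := [set k | (k <= n)%N])).
    by move=> t u _ _; exact: injh.
  by apply: sub_finite_set (finite_II n.+1) => k /=; rewrite ltnS.
have finF n : finite_set (F n).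
  apply: finle => x y exy; apply: down1_inj.
  by apply: inje exy; rewrite inE; exact: ideal_down1.
have finA n : finite_set (A n).
  apply: sub_finite_set (finle _ (fun I : nonprincipal_ideals P => e (val I))
    n _) => [I []//|I J eIJ].
  apply: val_inj; apply: inje eIJ; rewrite inE.
    by have [] := set_valP I.
  by have [] := set_valP J.
have dcK n : sub_dcpo (K n).
  by apply: (chain_union_sub_dcpo (I := val)) => // I [].
have monK (n m : nat) : (n <= m)%N -> K n `<=` K m.
  move=> nm x [Fx|[I [eI supI] Ix]]; first by left; exact: leq_trans nm.
  by right; exists I => //; split=> //; exact: leq_trans nm.
have covK : [set: P] = \bigcup_n K n.
  apply/seteqP; split=> // x _; exists (e (down [set x])) => //.
  by left; exact: leqnn.
exists K; split=> // [n|U].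
  apply: locally_finite_scott.
  apply: (finite_nonprincipal_ideals_restr (val @` A n)).
    exact: finite_image.
  move=> E dirE EK.
  have [|[I AI EI]] := directed_chain_union (finA n) (finF n)
    (fun I _ => asc I) dirE EK; first by left.
  by right; rewrite EI; exists I.
split=> [oU n|oU]; first exact: scott_open_restr.
apply: (scott_open_of_traces K) => // I x npI Ix.
pose J : nonprincipal_ideals P := SigSub (mem_set npI).
have KJ : chain_hull (s J) `<=` K (e I).
  by move=> y Jy; right; exists J => //; split=> //; exists x.
exists (e I), (range (s J)); split.
- exact: directed_ascending (asc J).
- exact: (asc J).2.
- by move=> y sy; apply: KJ; left.
- by apply: KJ; right; rewrite -supremums_down -(asc J).2.
Qed.

Lemma sub_dcpo_d_subposet (S : set P) : sub_dcpo S -> d_subposet S.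
Proof.
move=> dcS D x dirD DS Dx; have [y Dy Sy] := dcS D dirD DS.
by rewrite (is_subset1_supremums Dx Dy).
Qed.

End LfOmega.

Theorem proposition4p25 (d : Order.disp_t) (P : porderType d)
    (hId : countable (ideals P)) :
  (c_poset P /\ lf_omega_poset P) /\
  (dcpo P -> c_dcpo P /\ lf_omega_dcpo P).
Proof.
have cP := c_poset_of_countable_ideals hId.
have lfP := lf_omega_sub_dcpo hId.
split; last by move=> dP; split; split.
split=> //; have [K [dcK lfK monK covK oK]] := lfP.
by exists K; split=> // n; exact: sub_dcpo_d_subposet.
Qed.
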